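(* Let $n\geq 3$ and let $S\in\{\mathcal{PT}_n,\mathcal{T}_n,\mathcal{I}_n\}$. Put $\epsilon=0$ if $S\in\{\mathcal{PT}_n,\mathcal{I}_n\}$ and $\epsilon=1$ if $S=\mathcal{T}_n$, and put $\theta=\frac{n+\epsilon}{2}$. For an integer $m$ with $\epsilon\le m<n$ let $I_m$ be the ideal of $S$ of all mappings of rank $\leq m$, and for $i\in\{\epsilon,\dots,m\}$ let $\mathcal{C}_i$ be the restriction of the Cayley table presentation of $I_m$ to the elements of rank at least $i$. (i) When $m\leq\theta$, $\mathcal{C}_i$ defines $I_m$ if and only if $i=\epsilon$. (ii) When $m>\theta$, $\mathcal{C}_i$ defines $I_m$ if and only if $i\leq 2m-n$.
   Context: Write $[n]=\{1,\dots,n\}$. $\mathcal{PT}_n$ is the monoid of all partial mappings $[n]\to[n]$ (including the empty map), $\mathcal{I}_n$ the submonoid of all partial bijections (injective partial maps), $\mathcal{T}_n$ the submonoid of all full mappings; the operation is composition, with maps written on the right. The rank of a map is the size of its image. With $U_i=\{\alpha\in I_m: i\le \mathrm{rank}(\alpha)\le m\}$, $$\mathcal{C}_i=\langle x_\alpha\ (\alpha\in U_i)\mid x_\alpha x_\beta=x_{\alpha\beta}\ (\alpha,\beta,\alpha\beta\in U_i)\rangle .$$ The generator $x_\alpha$ represents $\alpha$. ''$\mathcal{C}_i$ defines $I_m$'' means that the homomorphism from the free semigroup on $\{x_\alpha:\alpha\in U_i\}$ to $I_m$ given by $x_\alpha\mapsto\alpha$ is surjective and its kernel is the congruence generated by the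 listed relations. *)

(* Defs.v *)
From HB Require Import structures.
From mathcomp Require Import all_boot all_order all_fingroup all_algebra.

Set Implicit Arguments.
Unset Strict Implicit.
Unset Printing Implicit Defensive.

Import GRing.Theory.

Local Open Scope group_scope.

(* A nonempty word a_0 a_1 ... a_k over A is encoded as its first letter paired
   with the sequence of the remaining ones. *)
Definition free_semigroup (A : Type) : Type := (A * seq A)%type.

Section FreeSemigroup.
Variable A : choiceType.

HB.instance Definition _ := Choice.on (free_semigroup A).

Definition word_mul (u v : free_semigroup A) : free_semigroup A :=
  (u.1, u.2 ++ v.1 :: v.2).

Fact word_mulA : associative word_mul.
Proof. by move=> u v w; rewrite /word_mul /= -catA. Qed.

HB.instance Definition _ := isSemigroup.Build (free_semigroup A) word_mulA.

Definition letter (a : A) : free_semigroup A := (a, [::]).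

Variables (G : semigroupType) (f : A -> G).

Definition word_eval (w : free_semigroup A) : G :=
  foldl (fun x a => x * f a) (f w.1) w.2.

Fact word_evalM (u v : free_semigroup A) :
  word_eval (u * v) = word_eval u * word_eval v.
Proof.
rewrite /word_eval /= foldl_cat /=.
elim/last_ind: v.2 => //= s a IHs.
by rewrite -!cats1 !foldl_cat /= IHs mulgA.
Qed.

HB.instance Definition _ :=
  isMultiplicative.Build (free_semigroup A) G word_eval word_evalM.

End FreeSemigroup.

Inductive congruence_gen (G : semigroupType) (R : G -> G -> Prop) :
    G -> G -> Prop :=
  | congr_base x y : R x y -> congruence_gen R x y
  | congr_refl x : congruence_gen R x x
  | congr_sym x y : congruence_gen R x y -> congruence_gen R y x
  | congr_trans x y z :
      congruence_gen R x y -> congruence_gen R y z -> congruence_gen R x z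
  | congr_mull z x y : congruence_gen R x y -> congruence_gen R (z * x) (z * y)
  | congr_mulr z x y : congruence_gen R x y -> congruence_gen R (x * z) (y * z).

(* < A | R > defines the subsemigroup J of G via the letter assignment f.
   The first clause says at once that words are mapped into J and that they are
   mapped onto J; the second one identifies the kernel. *)
Definition defines (A : choiceType) (G : semigroupType) (f : A -> G)
    (R : free_semigroup A -> free_semigroup A -> Prop) (J : {pred G}) : Prop :=
  (forall x : G, x \in J <-> exists w, word_eval f w = x) /\
  (forall u v, word_eval f u = word_eval f v <-> congruence_gen R u v).

(* The points 1, ..., n are represented by 'I_n, and None means undefined. *)
Definition partial_map (n : nat) : Type := {ffun 'I_n -> option 'I_n}.

Section PartialMaps.
Variable n : nat.
Implicit Types (a b : partial_map n) (S : {set partial_map n}).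

HB.instance Definition _ := Finite.on (partial_map n).

(* Maps are written on the right: x (a * b) = (x a) b. *)
Definition partial_mul (a b : partial_map n) : partial_map n :=
  [ffun x => obind b (a x)].

Definition partial_one : partial_map n := [ffun x => Some x].

Fact partial_mulA : associative partial_mul.
Proof.
by move=> a b c; apply/ffunP=> x; rewrite !ffunE; case: (a x) => //= y; rewrite ffunE.
Qed.

Fact partial_mul1 : left_id partial_one partial_mul.
Proof. by move=> a; apply/ffunP=> x; rewrite !ffunE. Qed.

Fact partial_mulr1 : right_id partial_one partial_mul.
Proof.
by move=> a; apply/ffunP=> x; rewrite !ffunE; case: (a x) => //= y; rewrite ffunE.
Qed.

HB.instance Definition _ :=
  isMonoid.Build (partial_map n) partial_mulA partial_mul1 partial_mulr1.

Definition partial_rank (a : partial_map n) : nat :=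
  #|[set y | [exists x, a x == Some y]]|.

Definition PT_monoid : {set partial_map n} := [set: partial_map n].

Definition T_monoid : {set partial_map n} :=
  [set a : partial_map n | [forall x, a x != None]].

Definition I_monoid : {set partial_map n} :=
  [set a : partial_map n |
    [forall x, forall y, (a x != None) && (a x == a y) ==> (x == y)]].

(* Only meant for S among the three monoids above; for 0 < n, T_monoid differs
   from the other two, so the test singles out the full mappings. *)
Definition epsilon S : nat := if S == T_monoid then 1%N else 0%N.

Definition theta S : rat := ((n + epsilon S)%:R / 2%:R)%R.

Definition rank_ideal S (m : nat) : {set partial_map n} :=
  [set a in S | partial_rank a <= m].

Definition rank_layer S (m i : nat) : {set partial_map n} :=
  [set a in rank_ideal S m | i <= partial_rank a].

Definition layer_elt S (m i : nat) : Type := {a : partial_map n | a \in rank_layer S m i}.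

HB.instance Definition _ S m i := Finite.on (layer_elt S m i).

Inductive Cayley_rel S (m i : nat) :
    free_semigroup (layer_elt S m i) -> free_semigroup (layer_elt S m i) -> Prop :=
  | Cayley_rel_intro (a b c : layer_elt S m i) : sval c = sval a * sval b ->
      Cayley_rel (letter a * letter b) (letter c).

Definition Cayley_defines S (m i : nat) : Prop :=
  defines (fun a : layer_elt S m i => sval a) (@Cayley_rel S m i)
    (mem (rank_ideal S m)).

End PartialMaps.

Arguments PT_monoid n : clear implicits.
Arguments T_monoid n : clear implicits.
Arguments I_monoid n : clear implicits.

(* Main.v *)
Require Import Defs.
From mathcomp Require Import all_boot all_order all_fingroup all_algebra.
From mathcomp Require Import zify.

Set Implicit Arguments.
Unset Strict Implicit.
Unset Printing Implicit Defensive.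

(**
Both parts say that C_i defines I_m exactly when i = epsilon or i <= 2m - n.

Necessity. If epsilon < i and i > 2m - n, there are al, be in S of rank m with
rank (al be) < i. A word equal to x_al x_be in the presented semigroup always
splits as a word for al followed by a word for be: a relation applied across the
splitting point would multiply a letter whose image is that of al by a letter
whose kernel is that of be, and that product has rank < i. Composing al with a
transposition pi and be with pi on the other side gives another factorization of
al be, so the kernel is not generated by the relations.

Sufficiency. Letters of rank r = i-1, i-2, ..., epsilon are added one rank at a
time. An element g of rank r is a product of two elements of rank > r, and the
point is that any two such factorizations are equal in the presented semigroup.
They are connected by slides (a k, b) ~ (a, k b), where a, k, b, a k, k b have
ranks in [r+1, m]. Slides bring (a, b) to a pair in which the first map is g with
some points moved to a new value q, and the second is the identity on the image of
g, brings q back, and sends one further point z to a new value s. Since r+2 <= m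
and r+3 <= n, there is room to change q, z, s and finally the moved points.
*)

Local Open Scope group_scope.

(** * Partial maps *)

Section PartialMapTheory.
Variable n : nat.
Implicit Types (a b c : partial_map n) (x y : 'I_n) (v : option 'I_n).
Implicit Types (A B E X Y : {set 'I_n}) (S : {set partial_map n}).

Lemma pmulE a b x : (a * b) x = obind b (a x).
Proof. by rewrite ffunE. Qed.

Definition im a : {set 'I_n} := [set y | [exists x, a x == Some y]].

Definition pimage b A : {set 'I_n} := [set y | [exists x in A, b x == Some y]].

Lemma imP a y : reflect (exists x, a x = Some y) (y \in im a).
Proof.
by rewrite inE; apply: (iffP existsP) => -[x]; [move/eqP|move=> ax]; exists x; rewrite ?ax.
Qed.

Lemma mem_im a x y : a x = Some y -> y \in im a.
Proof. by move=> axy; apply/imP; exists x. Qed.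

Lemma pimageP b A y :
  reflect (exists2 x, x \in A & b x = Some y) (y \in pimage b A).
Proof.
rewrite inE; apply: (iffP existsP) => [[x /andP[xA /eqP bx]]|[x xA bx]]; exists x => //.
by rewrite xA bx /=.
Qed.

Lemma rankE a : partial_rank a = #|im a|. Proof. by []. Qed.

Lemma imM a b : im (a * b) = pimage b (im a).
Proof.
apply/setP => y; apply/imP/pimageP => [[x]|[z /imP[x axz] bzy]].
  by rewrite pmulE; case axz: (a x) => [z|] //= bzy; exists z; rewrite ?(mem_im axz).
by exists x; rewrite pmulE axz.
Qed.

Lemma card_pimage b A : #|pimage b A| <= #|A|.
Proof.
suff sub : pimage b A \subset [set odflt x (b x) | x in A].
  exact: leq_trans (subset_leq_card sub) (leq_imset_card _ _).
apply/subsetP => y /pimageP[x xA bx]; apply/imsetP; exists x => //.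
by rewrite bx.
Qed.

Lemma pimage_sub b A : pimage b A \subset im b.
Proof. by apply/subsetP => y /pimageP[x _ bx]; rewrite (mem_im bx). Qed.

Lemma pimageS b A B : A \subset B -> pimage b A \subset pimage b B.
Proof.
move=> /subsetP AB; apply/subsetP => y /pimageP[x xA bx].
by apply/pimageP; exists x => //; apply: AB.
Qed.

Lemma pimageT b : pimage b setT = im b.
Proof.
apply/setP => y; apply/pimageP/imP => -[x]; first by move=> _; exists x.
by exists x; rewrite ?inE.
Qed.

(** Each point of [Y] outside [X] contributes at most one value beyond the image of [X]. The
    inequality is arranged additively to avoid truncated subtraction. *)
Lemma card_pimage_diff b X Y : X \subset Y ->
  #|pimage b Y| + #|X| <= #|pimage b X| + #|Y|.
Proof.
move=> XY; rewrite -(cardsID X Y) (setIidPr XY) addnCA addnC leq_add2l.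
apply: leq_trans (leq_add (leqnn _) (card_pimage b _)).
apply: leq_trans (leq_card_setU _ _); apply/subset_leq_card/subsetP => y.
move=> /pimageP[x xY bx]; rewrite inE; have [xX|xX] := boolP (x \in X).
  by apply/orP; left; apply/pimageP; exists x.
by apply/orP; right; apply/pimageP; exists x; rewrite ?inE ?xX.
Qed.

Lemma rank_mull a b : partial_rank (a * b) <= partial_rank a.
Proof. by rewrite !rankE imM card_pimage. Qed.

Lemma rank_mulr a b : partial_rank (a * b) <= partial_rank b.
Proof. by rewrite !rankE imM subset_leq_card ?pimage_sub. Qed.

(** These are the points that can be sent elsewhere without losing any value of [b] on [A]; see
    [pimage_upd]. *)
Definition nonisolated b A x :=
  b x = None \/ (exists2 x', x' \in A & x' <> x /\ b x' = b x).

Lemma ex_nonisolated b A : #|pimage b A| < #|A| ->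
  exists2 x, x \in A & nonisolated b A x.
Proof.
move=> lt.
have [/existsP[x /andP[xA /orP[/eqP bx|/existsP[x' /and3P[x'A /eqP ne /eqP bx]]]]]|] :=
  boolP [exists x in A, (b x == None) || [exists x' in A, (x' != x) && (b x' == b x)]].
- by exists x => //; left.
- by exists x => //; right; exists x'.
rewrite negb_exists => /forallP isol; suff: false by [].
move: lt; rewrite ltnNge => /negP[].
have tot x : x \in A -> b x <> None.
  by move=> xA bx; have := isol x; rewrite xA bx eqxx.
(* The default [x] is never taken on [A], where [b] is now total. If all points are isolated, [b] is
   injective on [A], against the strict inequality. *)
have inj : {in A &, injective (fun x => odflt x (b x))}.
  move=> x y xA yA; case bx: (b x) (tot x xA) => [u|] // _.
  case By: (b y) (tot y yA) => [w|] //= _ uw; apply/eqP; apply: contraT => nxy.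
  have := isol x; rewrite xA /= negb_or negb_exists => /andP[_ /forallP/(_ y)].
  by rewrite yA bx By uw eq_sym nxy eqxx.
rewrite -(card_in_imset inj); apply/subset_leq_card/subsetP => _ /imsetP[x xA ->].
by apply/pimageP; exists x => //; case: (b x) (tot x xA).
Qed.

Lemma ex_pimage_new b A B : #|B| < #|pimage b A| ->
  exists z s, [/\ z \in A, b z = Some s & s \notin B].
Proof.
move=> lt; have /subsetPn[s /pimageP[z zA bz] sB] : ~~ (pimage b A \subset B).
  by apply: contraL lt => /subset_leq_card; rewrite -leqNgt.
by exists z, s.
Qed.

Lemma ex_notin A : #|A| < n -> exists x, x \notin A.
Proof.
move=> lt; have /subsetPn[x _ xA] : ~~ (setT \subset A); last by exists x.
by apply: contraL lt => /subset_leq_card; rewrite cardsT card_ord -leqNgt.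
Qed.

(** * Point updates and partial identities *)

Definition upd a x v : partial_map n := [ffun y => if y == x then v else a y].

Definition idmap A v : partial_map n := [ffun y => if y \in A then Some y else v].

Lemma updE a x v y : upd a x v y = if y == x then v else a y.
Proof. by rewrite ffunE. Qed.

Lemma idmapE A v y : idmap A v y = if y \in A then Some y else v.
Proof. by rewrite ffunE. Qed.

Lemma updM a x v b : upd a x v * b = upd (a * b) x (obind b v).
Proof. by apply/ffunP => y; rewrite !ffunE; case: ifP. Qed.

Lemma im_upd_new a x w : im (upd a x (Some w)) \subset w |: im a.
Proof.
apply/subsetP => y /imP[u]; rewrite updE; case: ifP => _.
  by case=> ->; rewrite setU11.
by move=> /mem_im; apply: (subsetP (subsetUr _ _)).
Qed.

Lemma pimage_upd b A p q : p \in A -> nonisolated b A p ->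
  q |: pimage b A \subset pimage (upd b p (Some q)) A.
Proof.
move=> pA isop; apply/subsetP => v /setU1P[->|/pimageP[u uA bu]]; apply/pimageP.
  by exists p; rewrite // updE eqxx.
have [eup|nup] := eqVneq u p; last by exists u; rewrite // updE (negPf nup).
move: isop => [bp|[p' p'A [/eqP np bp]]]; first by rewrite -eup bu in bp.
by exists p'; rewrite // updE (negPf np) bp -eup.
Qed.

Definition fixes A a := {in A, forall x, a x = Some x}.

Lemma fixes_mul A a k : im a \subset A -> fixes A k -> a * k = a.
Proof.
move=> /subsetP aA kA; apply/ffunP => x; rewrite pmulE.
by case ax: (a x) => [y|] //=; rewrite kA ?aA ?(mem_im ax).
Qed.

Lemma fixes_sub A k : fixes A k -> A \subset im k.
Proof. by move=> kA; apply/subsetP => x /kA/mem_im. Qed.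

Lemma fixes_upd A a x v : x \notin A -> fixes A a -> fixes A (upd a x v).
Proof. by move=> xA aA y yA; rewrite updE (negPf (memPn xA _ yA)) aA. Qed.

Lemma fixes_idmap A v : fixes A (idmap A v).
Proof. by move=> x xA; rewrite idmapE xA. Qed.

Lemma fixesW A B a : A \subset B -> fixes B a -> fixes A a.
Proof. by move=> /subsetP AB aB x /AB/aB. Qed.

Lemma im_idmap A v : (forall x, v = Some x -> x \in A) -> im (idmap A v) = A.
Proof.
move=> vA; apply/eqP; rewrite eqEsubset fixes_sub ?andbT; last exact: fixes_idmap.
by apply/subsetP => y /imP[x]; rewrite idmapE; case: ifP => [xA [<-]|_ /vA].
Qed.

(* The values that may be assigned to several points at once, within S, by a map
   whose image contains D. *)
Definition collapsible S A v :=
  [/\ forall x, v = Some x -> x \in A, S = T_monoid n -> v <> None &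
      S = I_monoid n -> v = None].

Lemma collapsibleW S A B v : A \subset B -> collapsible S A v -> collapsible S B v.
Proof. by move=> /subsetP AB [vA vT vI]; split => // x /vA/AB. Qed.

(** * Closure properties of the three monoids *)

Section Submonoid.
Variable S : {set partial_map n}.
Hypothesis S_in : [\/ S = PT_monoid n, S = T_monoid n | S = I_monoid n].

Lemma TP a : reflect (forall x, a x <> None) (a \in T_monoid n).
Proof. by rewrite inE; apply: (iffP forallP) => h x; apply/eqP. Qed.

Lemma IP a : reflect (forall x y, a x <> None -> a x = a y -> x = y)
  (a \in I_monoid n).
Proof.
rewrite inE; apply: (iffP forallP) => h x.
  move=> y ax axy; apply/eqP; have /forallP/(_ y) := h x.
  by rewrite axy eqxx andbT => /implyP; apply; rewrite -axy; apply/eqP.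
by apply/forallP => y; apply/implyP => /andP[/eqP ax /eqP axy]; apply/eqP/h.
Qed.

Lemma S_mul a b : a \in S -> b \in S -> a * b \in S.
Proof.
case: S_in => ->; first by rewrite !inE.
  move=> /TP aT /TP bT; apply/TP => x; rewrite pmulE.
  by case: (a x) (aT x) => //= y _; apply: bT.
move=> /IP aI /IP bI; apply/IP => x y; rewrite !pmulE.
case ax: (a x) => [u|] //= bu; case ay: (a y) => [w|] //= buw.
by apply: aI; rewrite ax // ay (bI u w).
Qed.

Lemma upd_new a x w : a \in S -> w \notin im a -> upd a x (Some w) \in S.
Proof.
case: S_in => ->; first by rewrite !inE.
  by move=> /TP aT _; apply/TP => y; rewrite updE; case: ifP.
move=> /IP aI wa; have {}wa y : a y <> Some w by move=> /mem_im; apply/negP.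
apply/IP => y z; rewrite !updE; case: eqP => [->|_]; case: eqP => [->|_] //.
- by move=> _ /esym/wa.
- by move=> _ /wa.
- exact: aI.
Qed.

Lemma upd_collapsible A a x v : a \in S -> collapsible S A v -> upd a x v \in S.
Proof.
move=> aS [_ vT vI]; move: aS; case: S_in => eS; rewrite eS; first by rewrite !inE.
  by move=> /TP aT; apply/TP => y; rewrite updE; case: ifP => // _; apply: vT.
move=> /IP aI; rewrite vI //; apply/IP => y z; rewrite !updE.
case: eqP => [_|_] //; case: eqP => [_|_] //; exact: aI.
Qed.

Lemma idmap_collapsible A B v : collapsible S A v -> idmap B v \in S.
Proof.
move=> [_ vT vI]; case: S_in => eS; rewrite eS; first by rewrite inE.
  by apply/TP => y; rewrite idmapE; case: ifP => // _; apply: vT.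
apply/IP => y z; rewrite !idmapE vI //.
by case: ifP => // _ _; case: ifP => // _ [].
Qed.

(** Injectivity rules out a shared value, so among partial bijections a nonisolated point is outside
    the domain; among full maps its value is defined. *)
Lemma collapsible_nonisolated A B b x : b \in S -> nonisolated b A x ->
  (forall y, b x = Some y -> y \in B) -> collapsible S B (b x).
Proof.
move=> bS isox bxB; split => // eS; rewrite eS in bS; first by move/TP: bS; apply.
case: isox => // -[x' _ [ne bx']]; apply/eqP; apply: contraT => /eqP bx.
by case: ne; move/IP: bS; apply; rewrite ?bx'.
Qed.

Lemma T_neq_I : 1 < n -> T_monoid n <> I_monoid n.
Proof.
move=> n_gt1 eTI; pose x := Ordinal (ltnW n_gt1); pose y := Ordinal n_gt1.
have : idmap set0 (Some x) \in I_monoid n.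
  by rewrite -eTI; apply/TP => z; rewrite idmapE inE.
by move=> /IP/(_ x y); rewrite !idmapE !inE => /(_ _ erefl) [].
Qed.

Lemma ex_collapsible A : 1 < n -> epsilon S <= #|A| -> exists v, collapsible S A v.
Proof.
move=> n_gt1; rewrite /epsilon; case: eqP => [eS A0|nS _].
  have [x xA] := card_gt0P A0; exists (Some x); split => // [y [<-] //|].
  by rewrite eS => /(T_neq_I n_gt1).
by exists None.
Qed.

End Submonoid.
End PartialMapTheory.

(** * Adding the elements of rank r to a presentation *)

Lemma cardsU1_le (T : finType) (x : T) (A : {set T}) : #|x |: A| <= #|A|.+1.
Proof. by rewrite cardsU1; case: (x \notin A) => /=; rewrite ?add0n ?add1n. Qed.

Section Extension.
Variables (n : nat) (S : {set partial_map n}) (m r : nat).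
Hypothesis S_in : [\/ S = PT_monoid n, S = T_monoid n | S = I_monoid n].
Hypotheses (m_lt_n : m < n) (n_gt1 : 1 < n) (eps_r : epsilon S <= r).
Hypothesis r_small : r.+1 + n <= m + m.

Variables (G : semigroupType) (R : G -> G -> Prop) (F : partial_map n -> G).
Local Notation "x ~~ y" := (congruence_gen R x y) (at level 70).
Local Notation I_m := (rank_ideal S m).
Local Notation U := (rank_layer S m r.+1).
Hypothesis FM : forall a b, a \in U -> b \in U -> a * b \in U -> F a * F b ~~ F (a * b).

Implicit Types (a b c k : partial_map n) (x y z q s w : 'I_n) (d v : option 'I_n).

Lemma memI a : a \in I_m = (a \in S) && (partial_rank a <= m).
Proof. by rewrite inE. Qed.

Lemma memU a : a \in U = (a \in I_m) && (r < partial_rank a).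
Proof. by rewrite inE. Qed.

Lemma ideal_mul a b : a \in I_m -> b \in I_m -> a * b \in I_m.
Proof.
rewrite !memI => /andP[aS am] /andP[bS _].
by rewrite S_mul //= (leq_trans (rank_mull _ _)).
Qed.

(** Both sides equal [F a * F k * F b]: the two rank bounds force [a], [k] and [b] into [U] as
    well. *)
Lemma slide a k b : a \in I_m -> k \in I_m -> b \in I_m ->
  r < partial_rank (a * k) -> r < partial_rank (k * b) ->
  F a * F (k * b) ~~ F (a * k) * F b.
Proof.
move=> aI kI bI ak kb.
have aU : a \in U by rewrite memU aI (leq_trans ak) ?rank_mull.
have kU : k \in U by rewrite memU kI (leq_trans ak) ?rank_mulr.
have bU : b \in U by rewrite memU bI (leq_trans kb) ?rank_mulr.
have akU : a * k \in U by rewrite memU ideal_mul.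
have kbU : k * b \in U by rewrite memU ideal_mul.
apply: congr_trans (congr_mulr _ (FM aU kU akU)).
by rewrite -mulgA; apply/congr_mull/congr_sym/FM.
Qed.

(** * Connecting all factorizations of an element of rank r *)

Section Factorizations.
Variable g : partial_map n.
Hypotheses (gS : g \in S) (rank_g : partial_rank g = r).
Local Notation D := (im g).
Variable d0 : option 'I_n.
Hypothesis d0P : collapsible S D d0.
Local Notation base := (idmap D d0).

Let cardD : #|D| = r. Proof. exact: rank_g. Qed.

(** Auxiliary maps are built from [base] one point at a time; the set [E] bounds the image, so that
    membership in [I_m] reduces to counting [E]. *)
Definition framed (E : {set 'I_n}) k := [/\ k \in S, fixes D k & im k \subset E].

Lemma framed_base : framed D base.
Proof.
split; [exact: idmap_collapsible d0P|exact: fixes_idmap|].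
by rewrite im_idmap //; case: d0P.
Qed.

Lemma framed_new E k x w :
  framed E k -> x \notin D -> w \notin E -> framed (w |: E) (upd k x (Some w)).
Proof.
move=> [kS kD kE] xD wE; split; last exact: subset_trans (im_upd_new _ _ _) (setUS _ kE).
  by apply: upd_new => //; apply: contra wE; apply/subsetP.
exact: fixes_upd.
Qed.

Lemma framed_collapsible E k x v : framed E k -> x \notin D ->
  collapsible S E v -> framed E (upd k x v).
Proof.
move=> [kS kD kE] xD vD; split; [exact: upd_collapsible vD|exact: fixes_upd|].
apply/subsetP => y /imP[u]; rewrite updE; case: ifP => [_ vy|_ /mem_im].
  by case: vD => /(_ _ vy).
exact: subsetP.
Qed.

Lemma framedI E k : framed E k -> #|E| <= m -> k \in I_m.
Proof.
by move=> [kS _ kE] Em; rewrite memI kS; apply: leq_trans (subset_leq_card kE) Em.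
Qed.

Lemma rank_gt k z s : fixes D k -> k z = Some s -> s \notin D -> r < partial_rank k.
Proof.
move=> kD kz sD; have : #|s |: D| <= #|im k|.
  by rewrite subset_leq_card // subUset sub1set (mem_im kz) fixes_sub.
by rewrite cardsU1 sD cardD.
Qed.

Lemma baseM k : fixes D k -> base * k = base.
Proof. by apply: fixes_mul; rewrite im_idmap //; case: d0P. Qed.

Lemma collapsibleM k v : collapsible S D v -> fixes D k -> obind k v = v.
Proof. by case: v => //= x [vD _ _] ->; rewrite ?vD. Qed.

(* a is g with some points of a single kernel class of g (or some points outside
   the domain of g) sent to a new value q; the remaining points are as in g. *)
Definition splits q d a :=
  [/\ a \in S, q \notin D, collapsible S D d, r < partial_rank a &
      forall x, a x = Some q /\ g x = d \/ a x = g x].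

Lemma splits_im q d a : splits q d a -> im a = q |: D.
Proof.
move=> [_ qD _ rk av]; apply/eqP; rewrite eqEcard cardsU1 qD cardD rk andbT.
apply/subsetP => y /imP[x]; case: (av x) => [[-> _] [<-]|->]; first exact: setU11.
by move=> /mem_im; apply: (subsetP (subsetUr _ _)).
Qed.

Lemma splitsI q d a : splits q d a -> a \in I_m.
Proof.
move=> sa; rewrite memI rankE (splits_im sa) cardsU1; case: sa => -> -> _ _ _ /=.
rewrite cardD; lia.
Qed.

Lemma splits_fix q d a k : splits q d a -> fixes D k -> k q = Some q -> a * k = a.
Proof.
move=> sa kD kq; apply: (@fixes_mul _ (q |: D)); first by rewrite (splits_im sa).
by move=> x /setU1P[->|/kD].
Qed.

Lemma g_fix k : fixes D k -> g * k = g.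
Proof. exact: fixes_mul. Qed.

Lemma splits_collapse q d a k : splits q d a -> fixes D k -> k q = d -> a * k = g.
Proof.
move=> [_ _ _ _ av] kD kq; rewrite -[RHS](g_fix kD); apply/ffunP => x.
rewrite !pmulE; case: (av x) => [[-> gx] /=|-> //]; rewrite kq gx.
by rewrite -gx -pmulE g_fix.
Qed.

Lemma splits_rename q d a k q' : splits q d a -> fixes D k -> k q = Some q' ->
  q' \notin D -> k \in S -> splits q' d (a * k).
Proof.
move=> sa kD kq q'D kS; case: (sa) => aS qD dD rk av; split => //.
- exact: S_mul.
- rewrite rankE imM (splits_im sa); have <- : #|q' |: D| = r.+1 by rewrite cardsU1 q'D cardD.
  apply/subset_leq_card/subsetP => y /setU1P[->|yD]; apply/pimageP.
    by exists q; rewrite ?setU11.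
  by exists y; rewrite ?kD // setU1r.
- move=> x; rewrite pmulE; case: (av x) => [[-> gx] /=|->]; [left|right] => //.
  by rewrite -pmulE g_fix.
Qed.

(** The normal form of a second factor: [q] is folded back to [d], while the extra point [z] with
    value [s] outside [D] raises the rank above r. *)
Definition folder q d z s := upd (upd base q d) z (Some s).

Let neqE q z : q != z -> ((q == z) = false) * ((z == q) = false).
Proof. by move=> qz; split; [|rewrite eq_sym]; apply: negPf. Qed.

Lemma folder_q q d z s : q != z -> folder q d z s q = d.
Proof. by move=> qz; rewrite !updE (neqE qz) eqxx. Qed.

Lemma folder_z q d z s : folder q d z s z = Some s.
Proof. by rewrite updE eqxx. Qed.

Lemma folder_fixes q d z s : q \notin D -> z \notin D -> fixes D (folder q d z s).
Proof. by move=> qD zD; do 2!apply: fixes_upd => //; apply: fixes_idmap. Qed.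

Lemma folderI q d z s : collapsible S D d -> q \notin D -> z \notin D -> s \notin D ->
  folder q d z s \in I_m.
Proof.
move=> dD qD zD sD; apply: (@framedI (s |: D)); last by rewrite cardsU1 sD cardD; lia.
by apply: framed_new => //; apply: framed_collapsible => //; apply: framed_base.
Qed.

Lemma folder_rank q d z s : q \notin D -> z \notin D -> s \notin D ->
  r < partial_rank (folder q d z s).
Proof.
by move=> qD zD sD; apply: (@rank_gt _ z s); rewrite ?updE ?eqxx //; apply: folder_fixes.
Qed.

(** Here [r_small] and [m < n] are combined into r + 2 <= m. Since [m < n], a further point outside
    such a set always exists. *)
Let card_two x y : #|x |: (y |: D)| <= m.
Proof. by have := cardsU1_le x (y |: D); have := cardsU1_le y D; rewrite cardD; lia. Qed.

Let notin_U1 x y : x != y -> x \notin D -> x \notin y |: D.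
Proof. by move=> xy xD; rewrite !inE negb_or xy; rewrite inE in xD. Qed.

(** The slid map [k] fixes [D] and sends [q] to [q'] and [z] to [z']; it is absorbed on the left by
    [a] and peeled off the old folder on the right. *)
Lemma slide_rename q d a z s q' z' :
  splits q d a -> z \notin D -> q != z -> q' \notin D -> z' \notin D -> q' != z' ->
  s \notin D ->
  exists2 a', splits q' d a' &
    [/\ q = q' -> a' = a, forall x, a x = Some q -> a' x = Some q' &
      F a * F (folder q d z s) ~~ F a' * F (folder q' d z' s)].
Proof.
move=> sa zD qz q'D z'D q'z' sD; have [aS qD dD _ _] := sa.
pose k := upd (upd base q (Some q')) z (Some z').
have fk : framed (z' |: (q' |: D)) k.
  apply: framed_new => //; last by rewrite notin_U1 // eq_sym.
  by apply: framed_new => //; apply: framed_base.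
have [kS kD _] := fk; have kq : k q = Some q' by rewrite !updE eqxx !(neqE qz).
have sa' := splits_rename sa kD kq q'D kS.
have kB : k * folder q' d z' s = folder q d z s.
  by rewrite !updM baseM /= ?folder_q ?folder_z //; apply: folder_fixes.
exists (a * k) => //; split; last 1 first.
- rewrite -kB; apply: slide; rewrite ?kB ?(splitsI sa) ?folder_rank //.
  + exact: framedI fk (card_two _ _).
  + exact: folderI.
  + by case: sa'.
- by move=> qq'; apply: splits_fix sa _ _ => //; rewrite kq qq'.
- by move=> x ax; rewrite pmulE ax /=.
Qed.

(** With a spare point [t], the map [J] takes [z] to [s] and [t] to [s'] at once. Both the folder at
    [z] and the folder at [t] are restrictions of [J] by maps that fix [a]; finally [t] is renamed
    to [z]. *)
Lemma slide_value q d a z s s' : splits q d a -> z \notin D -> q != z ->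
  s \notin D -> s' \notin D ->
  F a * F (folder q d z s) ~~ F a * F (folder q d z s').
Proof.
move=> sa zD qz sD s'D; have [<-|ss'] := eqVneq s s'; first exact: congr_refl.
have [aS qD dD rk _] := sa.
have [t] : exists t, t \notin z |: (q |: D) by apply/ex_notin/leq_ltn_trans/m_lt_n/card_two.
rewrite in_setU1 negb_or => /andP[tz]; rewrite in_setU1 negb_or => /andP[tq tD].
pose J := upd (upd (upd base q d) t (Some s')) z (Some s).
have fJ : framed (s |: (s' |: D)) J.
  apply: framed_new => //; last exact: notin_U1.
  apply: framed_new => //.
  by apply: framed_collapsible => //; apply: framed_base.
have [_ JD _] := fJ; have JI := framedI fJ (card_two _ _).
have Jq : J q = d by rewrite !updE (neqE qz) (neqE tq) eqxx.
have Jz : J z = Some s by rewrite updE eqxx.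
have Jt : J t = Some s' by rewrite !updE (neqE tz) eqxx.
have join y w : y \notin D -> q != y -> w \notin D -> J y = Some w ->
  F a * F (folder q d y w) ~~ F a * F J.
  move=> yD qy wD Jy; pose e := upd (upd base q (Some q)) y (Some y).
  have fe : framed (y |: (q |: D)) e.
    apply: framed_new => //; last by rewrite notin_U1 // eq_sym.
    by apply: framed_new => //; apply: framed_base.
  have [eS eD _] := fe.
  have ae : a * e = a by apply: splits_fix sa _ _ => //; rewrite !updE (neqE qy) eqxx.
  have eJ : e * J = folder q d y w by rewrite !updM baseM //= Jq Jy.
  rewrite -eJ -{2}ae; apply: slide; rewrite ?eJ ?(splitsI sa) ?ae ?folder_rank //.
  exact: framedI fe (card_two _ _).
have qt : q != t by rewrite eq_sym.
apply: congr_trans (join z s zD qz sD Jz) _.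
apply: congr_trans (congr_sym (join t s' tD qt s'D Jt)) _.
have [a' _ [aa' _ eq]] := slide_rename sa tD qt qD zD qz s'D.
by rewrite aa' in eq.
Qed.

Lemma splits_upd y q : nonisolated g setT y -> q \notin D ->
  splits q (g y) (upd g y (Some q)).
Proof.
move=> isoy qD; split => //.
- exact: upd_new.
- by apply: collapsible_nonisolated isoy _ => // x; apply: mem_im.
- have <- : #|q |: D| = r.+1 by rewrite cardsU1 qD cardD.
  by rewrite rankE -(pimageT g) -(pimageT (upd _ _ _)) subset_leq_card ?pimage_upd.
- by move=> x; rewrite updE; case: eqP => [->|_]; [left|right].
Qed.

(** The intermediate map [a2] moves [y] to [q'] on top of what [a] moves. Sending [q'] back to [a y]
    recovers [a], and sending [q] back to [d] leaves [g] with only [y] moved. *)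
Lemma slide_split q d a y q' z s : splits q d a -> nonisolated g setT y ->
  z \notin D -> q' \notin D -> s \notin D -> q != z -> q' != z -> q != q' ->
  F a * F (folder q d z s) ~~ F (upd g y (Some q')) * F (folder q' (g y) z s).
Proof.
move=> sa isoy zD q'D sD qz q'z qq'; have [aS qD dD rk av] := sa.
have sa' := splits_upd isoy q'D; have [_ _ gyD rk' _] := sa'.
(* For partial bijections with [a y = Some q], the map [k] below would send both [q] and [q'] to
   [q]. But then [y] is the only point moved, and renaming [q] to [q'] is enough. *)
have [[eS ay]|nIq] : (S = I_monoid n /\ a y = Some q) \/ ~ (S = I_monoid n /\ a y = Some q).
- by case: (eqVneq S (I_monoid n)) (eqVneq (a y) (Some q)) => [->|/eqP nS] [->|/eqP nq];
    [left|right|right|right]; tauto.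
- have [a' sa2 [_ aa' eq]] := slide_rename sa zD qz q'D zD q'z sD.
  case: (sa2) => a'S _ _ _ a'v; rewrite eS in a'S; move/IP: a'S => a'S.
  have a'y := aa' y ay.
  have -> : upd g y (Some q') = a'.
    apply/ffunP => x; rewrite updE; case: eqP => [->//|nxy].
    case: (a'v x) => // -[a'x _]; case: nxy; apply: a'S; rewrite ?a'x ?a'y //.
  suff -> : g y = d by [].
  case: (av y) => [[_ //]|e]; rewrite ay in e.
  by rewrite (mem_im (esym e)) in qD.
have ayE : collapsible S (q |: D) (a y).
  case: (av y) => [[ay _]|->]; last exact: collapsibleW (subsetUr _ _) gyD.
  rewrite ay; split=> // [x [<-]|eS]; first exact: setU11.
  by case: nIq.
pose k := upd (upd (upd base q (Some q)) q' (a y)) z (Some z).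
pose k' := upd (upd (upd base q d) q' (Some q')) z (Some z).
have fk : framed (z |: (q |: D)) k.
  apply: framed_new => //; last by rewrite notin_U1 // eq_sym.
  apply: framed_collapsible => //; apply: framed_new => //; exact: framed_base.
have fk' : framed (z |: (q' |: D)) k'.
  apply: framed_new => //; last by rewrite notin_U1 // eq_sym.
  apply: framed_new => //; apply: framed_collapsible => //; exact: framed_base.
have [_ kD _] := fk; have [_ k'D _] := fk'.
have [kI k'I] := (framedI fk (card_two _ _), framedI fk' (card_two _ _)).
pose a2 := upd a y (Some q').
have q'a : q' \notin im a by rewrite (splits_im sa) notin_U1 // eq_sym.
have a2I : a2 \in I_m.
  rewrite memI upd_new //=; apply: leq_trans (subset_leq_card (im_upd_new _ _ _)) _.
  by rewrite (splits_im sa) card_two.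
have a2k : a2 * k = a.
  rewrite updM (splits_fix sa kD) /=; last by rewrite !updE (neqE qz) (neqE qq') eqxx.
  rewrite !updE (neqE q'z) eqxx; apply/ffunP => x.
  by rewrite updE; case: eqP => [->|].
have a2k' : a2 * k' = upd g y (Some q').
  rewrite updM (splits_collapse sa k'D) /=; last by rewrite !updE (neqE qz) (neqE qq') eqxx.
  by rewrite !updE (neqE q'z) eqxx.
pose b := upd (upd (upd base q d) q' (g y)) z (Some s).
have kb : k * folder q d z s = b.
  rewrite !updM baseM /= ?folder_q ?folder_z //; last exact: folder_fixes.
  rewrite -pmulE (splits_collapse sa) // ?folder_q //; exact: folder_fixes.
have kb' : k' * folder q' (g y) z s = b.
  rewrite !updM baseM /= ?folder_q ?folder_z //; last exact: folder_fixes.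
  rewrite (collapsibleM dD) //; exact: folder_fixes.
have bD : fixes D b by do 3!apply: fixes_upd => //; apply: fixes_idmap.
have rb : r < partial_rank b by apply: (@rank_gt _ z s); rewrite ?updE ?eqxx.
have fI := folderI dD qD zD sD; have fI' := folderI gyD q'D zD sD.
apply: congr_trans (congr_sym _) _.
  by rewrite -a2k; apply: slide; rewrite ?a2k ?kb.
by rewrite kb -kb' -a2k'; apply: slide; rewrite ?a2k' ?kb'.
Qed.

(** The second factor is cut down to the image of [a] and one further point [z] whose value lies
    outside [D], which leaves rank exactly r + 1. *)
Lemma shrink_right a b : a \in U -> b \in U -> a * b = g ->
  exists b', [/\ b' \in U, a * b' = g, partial_rank b' < m & F a * F b ~~ F a * F b'].
Proof.
rewrite !memU => /andP[aI ra] /andP[bI rb] ab.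
have [lt|ge] := ltnP (partial_rank b) m.
  by exists b; split => //; [rewrite memU bI|exact: congr_refl].
have DE : D = pimage b (im a) by rewrite -ab imM.
(* If [b] has rank m, then m + rank [a] <= r + n, and [r_small] leaves rank [a] < m, hence room for
   [z]. *)
have Am : #|im a| < m.
  have := card_pimage_diff b (subsetT (im a)).
  rewrite pimageT cardsT card_ord -DE cardD; rewrite rankE in ge; lia.
have [z [s [_ bz sD]]] : exists z s, [/\ z \in setT, b z = Some s & s \notin D].
  by apply: ex_pimage_new; rewrite pimageT cardD.
have za : z \notin im a.
  by apply: contra sD => za; rewrite DE; apply/pimageP; exists z.
have [v vP] : exists v, collapsible S (im a) v.
  by apply: ex_collapsible => //; rewrite -rankE; lia.
have [bS aS] : b \in S /\ a \in S by move: aI bI; rewrite !memI => /andP[-> _] /andP[].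
pose e := upd (idmap (im a) v) z (Some z).
have imv : im (idmap (im a) v) = im a by apply: im_idmap; case: vP.
have eS : e \in S by apply: upd_new; rewrite ?imv // (idmap_collapsible _ _ vP).
have eE : im e \subset z |: im a by have := im_upd_new (idmap (im a) v) z z; rewrite imv.
have eI : e \in I_m.
  rewrite memI eS (leq_trans (subset_leq_card eE)) //.
  exact: leq_trans (cardsU1_le _ _) Am.
have ae : a * e = a.
  by apply: fixes_mul (subxx _) _; apply: fixes_upd => //; apply: fixes_idmap.
have reb : r < partial_rank (e * b).
  have <- : #|s |: D| = r.+1 by rewrite cardsU1 sD cardD.
  apply/subset_leq_card; rewrite subUset sub1set.
  rewrite (@mem_im _ _ z) ?pmulE ?updE ?eqxx //=.
  by rewrite -{1}ab -{1}ae -mulgA imM pimage_sub.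
have rebm : partial_rank (e * b) <= r.+1.
  rewrite rankE -cardD (leq_trans _ (cardsU1_le s D)) // subset_leq_card //.
  rewrite imM DE; apply: subset_trans (pimageS _ eE) _.
  apply/subsetP => y /pimageP[x /setU1P[->|xa] bx].
    by move: bx; rewrite bz => -[<-]; rewrite setU11.
  by rewrite setU1r //; apply/pimageP; exists x.
exists (e * b); split.
- by rewrite memU reb ideal_mul.
- by rewrite mulgA ae.
- lia.
- by apply: congr_sym; rewrite -{2}ae; apply: slide => //; rewrite ae.
Qed.

(** Some [p] in the image of [a] is nonisolated for [b], as the product has smaller rank than [a].
    Redirecting [p] to a value [q] missed by [b] factors [b] as [k * b'], and [k] slides left. The
    bound on rank [b] leaves room for [q]. *)
Lemma to_splits a b : a \in U -> b \in U -> a * b = g -> partial_rank b < m ->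
  exists q d a' b', [/\ splits q d a', b' \in I_m, r < partial_rank b',
    fixes D b' /\ b' q = d & F a * F b ~~ F a' * F b'].
Proof.
rewrite !memU => /andP[aI ra] /andP[bI rb] ab bm.
have DE : D = pimage b (im a) by rewrite -ab imM.
have [aS bS] : a \in S /\ b \in S by move: aI bI; rewrite !memI => /andP[-> _] /andP[].
have [p pa isop] : exists2 p, p \in im a & nonisolated b (im a) p.
  by apply: ex_nonisolated; rewrite -DE cardD.
have bpD y : b p = Some y -> y \in D by move=> bp; rewrite DE; apply/pimageP; exists p.
have dP : collapsible S D (b p) by apply: collapsible_nonisolated isop _.
have [q qb] : exists q, q \notin im b by apply: ex_notin; apply: ltn_trans m_lt_n.
have Db : D \subset im b by rewrite DE pimage_sub.
have qD : q \notin D by apply: contra qb; apply: subsetP.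
pose k := upd b p (Some q); pose b' := upd (idmap (im b) d0) q (b p).
have kS : k \in S by apply: upd_new.
have kI : k \in I_m.
  rewrite memI kS (leq_trans (subset_leq_card (im_upd_new _ _ _))) //.
  exact: leq_trans (cardsU1_le _ _) bm.
have fixb' : fixes (im b) b' by apply: fixes_upd => //; apply: fixes_idmap.
have b'S : b' \in S.
  by apply: upd_collapsible dP => //; apply: idmap_collapsible d0P.
have b'I : b' \in I_m.
  rewrite memI b'S (leq_trans _ (ltnW bm)) // subset_leq_card //; apply/subsetP => y /imP[x].
  rewrite updE idmapE; case: ifP => _; first exact: mem_im.
  case: ifP => [xb [<-] //|_ d0y]; apply: (subsetP Db).
  by case: d0P => /(_ _ d0y).
have kb' : k * b' = b.
  rewrite updM (fixes_mul (subxx _)) //= updE eqxx; apply/ffunP => x.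
  by rewrite updE; case: eqP => [->|].
have sak : splits q (b p) (a * k).
  have akv x : (a * k) x = Some q /\ g x = b p \/ (a * k) x = g x.
    rewrite -ab !pmulE; case: (a x) => [u|] /=; last by right.
    by rewrite updE; case: eqP => [->|_]; [left|right].
  split => //; first exact: S_mul.
  have <- : #|q |: D| = r.+1 by rewrite cardsU1 qD cardD.
  by rewrite rankE imM DE subset_leq_card ?pimage_upd.
have rb' : r < partial_rank b' by apply: leq_trans rb _; rewrite -kb' rank_mulr.
exists q, (b p), (a * k), b'; split => //.
  by split; [apply: fixesW fixb'|rewrite updE eqxx].
by rewrite -{1}kb'; apply: slide; rewrite ?kb' //; case: sak.
Qed.

(** Only [D], [q] and one point [z] witnessing the rank of [b] matter: a partial identity [e] on
    these is absorbed by [a] and forgets the rest of [b]. *)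
Lemma to_folder q d a b : splits q d a -> b \in I_m -> r < partial_rank b ->
  fixes D b -> b q = d ->
  exists z s, [/\ z \notin D, q != z, s \notin D & F a * F b ~~ F a * F (folder q d z s)].
Proof.
move=> sa bI rb bD bq; have [aS qD dD _ _] := sa.
have [z [s [_ bz sD]]] : exists z s, [/\ z \in setT, b z = Some s & s \notin D].
  by apply: ex_pimage_new; rewrite pimageT cardD.
have zD : z \notin D by apply: contra sD => zD; move: bz; rewrite bD // => -[<-].
have qz : q != z.
  by apply: contra sD => /eqP qz; case: dD => dD _ _; apply: dD; rewrite -bq qz.
exists z, s; split => //.
pose e := upd (upd base q (Some q)) z (Some z).
have fe : framed (z |: (q |: D)) e.
  apply: framed_new => //; last by rewrite notin_U1 // eq_sym.
  by apply: framed_new => //; apply: framed_base.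
have [eS eD _] := fe.
have ae : a * e = a by apply: splits_fix sa _ _ => //; rewrite !updE (neqE qz) eqxx.
have eb : e * b = folder q d z s by rewrite !updM baseM //= bq bz.
apply: congr_sym; rewrite -eb -{2}ae; apply: slide; rewrite ?eb ?(splitsI sa) ?ae ?folder_rank //.
  exact: framedI fe (card_two _ _).
by case: sa.
Qed.

Lemma factorization_unique a b y q z s : a \in U -> b \in U -> a * b = g ->
  nonisolated g setT y -> q \notin D -> z \notin D -> q != z -> s \notin D ->
  F a * F b ~~ F (upd g y (Some q)) * F (folder q (g y) z s).
Proof.
move=> aU bU ab isoy qD zD qz sD.
have [b1 [b1U ab1 b1m e1]] := shrink_right aU bU ab.
apply: congr_trans e1 _.
have [q2 [d [a2 [b2 [sa2 b2I rb2 [b2D b2q] e2]]]]] := to_splits aU b1U ab1 b1m.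
apply: congr_trans e2 _.
have [z3 [s3 [z3D q23 s3D e3]]] := to_folder sa2 b2I rb2 b2D b2q.
apply: congr_trans e3 _.
apply: congr_trans (slide_value sa2 z3D q23 s3D sD) _.
(* [slide_split] needs old and new values distinct, so the old value is first renamed to a fresh
   [t]. *)
have [t] : exists t, t \notin z |: (q |: D) by apply/ex_notin/leq_ltn_trans/m_lt_n/card_two.
rewrite in_setU1 negb_or => /andP[tz]; rewrite in_setU1 negb_or => /andP[tq tD].
have [a4 sa4 [_ _ e4]] := slide_rename sa2 z3D q23 tD zD tz sD.
by apply: congr_trans e4 _; apply: slide_split.
Qed.

Lemma canonical_factorization y q z s : nonisolated g setT y ->
  q \notin D -> z \notin D -> q != z -> s \notin D ->
  [/\ upd g y (Some q) \in U, folder q (g y) z s \in U &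
      upd g y (Some q) * folder q (g y) z s = g].
Proof.
move=> isoy qD zD qz sD; have sg := splits_upd isoy qD; have [_ _ gyD rk _] := sg.
rewrite !memU (splitsI sg) rk folderI ?folder_rank //; split => //.
by apply: splits_collapse sg _ _; rewrite ?folder_q //; apply: folder_fixes.
Qed.

End Factorizations.

(** * Multiplicativity of the extended assignment *)

Local Notation V := (rank_layer S m r).

(* The value at an element of rank r is read off an arbitrary factorization. *)
Definition extend a :=
  if a \in U then F a else
  if [pick p | [&& p.1 \in U, p.2 \in U & p.1 * p.2 == a]] is Some p
  then F p.1 * F p.2 else F a.

Lemma extendU a : a \in U -> extend a = F a.
Proof. by rewrite /extend => ->. Qed.

Lemma layerV_cases a : a \in V -> a \in U \/ a \in S /\ partial_rank a = r.
Proof.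
rewrite inE => /andP[aI]; rewrite memU aI leq_eqVlt => /orP[/eqP <-|->]; [right|by left].
by move: aI; rewrite memI => /andP[].
Qed.

Lemma ex_two_notin (A : {set 'I_n}) : #|A| = r ->
  exists q z, [/\ q \notin A, z \notin A & q != z].
Proof.
move=> cA; have [q qA] : exists q, q \notin A by apply: ex_notin; lia.
have [z] : exists z, z \notin q |: A.
  apply: ex_notin; apply: leq_ltn_trans (cardsU1_le _ _) _; rewrite cA; lia.
by rewrite in_setU1 negb_or eq_sym => /andP[qz zA]; exists q, z.
Qed.

Lemma ex_factorization g y q s : g \in S -> partial_rank g = r ->
  nonisolated g setT y -> q \notin im g -> s \notin im g ->
  exists f, [/\ upd g y (Some q) \in U, f \in U, upd g y (Some q) * f = g,
    fixes (im g) f & s \in im f].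
Proof.
move=> gS rg isoy qD sD.
have [d0 d0P] : exists v, collapsible S (im g) v.
  by apply: ex_collapsible => //; rewrite -rankE rg.
have [z] : exists z, z \notin q |: im g.
  apply: ex_notin; apply: leq_ltn_trans (cardsU1_le _ _) _; rewrite -rankE rg; lia.
rewrite in_setU1 negb_or eq_sym => /andP[qz zD].
have [uU fU uf] := canonical_factorization gS rg d0P isoy qD zD qz sD.
exists (folder g d0 q (g y) z s); split => //; first exact: folder_fixes.
by rewrite (@mem_im _ _ z) ?folder_z.
Qed.

Lemma ex_nonisolatedT g : partial_rank g = r -> exists y, nonisolated g setT y.
Proof.
move=> rg; have [y _ isoy] : exists2 y, y \in setT & nonisolated g setT y; last by exists y.
by apply: ex_nonisolated; rewrite pimageT cardsT card_ord -rankE rg; lia.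
Qed.

Lemma extend_factorization g : g \in S -> partial_rank g = r ->
  exists a b, [/\ a \in U, b \in U, a * b = g & extend g = F a * F b].
Proof.
move=> gS rg; have [y isoy] := ex_nonisolatedT rg.
have [q [_ [qD _ _]]] : exists q z, [/\ q \notin im g, z \notin im g & q != z].
  exact: ex_two_notin.
have [f [uU fU uf _ _]] := ex_factorization gS rg isoy qD qD.
rewrite /extend memU rg ltnn andbF; case: pickP => [[a b] /and3P[/= aU bU /eqP ab]|].
  by exists a, b.
by move/(_ (upd g y (Some q), f)); rewrite /= uU fU uf eqxx.
Qed.

Lemma extend_mulUU a b : a \in U -> b \in U -> a * b \in V -> F a * F b ~~ extend (a * b).
Proof.
move=> aU bU /layerV_cases[abU|[abS rab]]; first by rewrite extendU //; apply: FM.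
have [c [d [cU dU cd ->]]] := extend_factorization abS rab.
have [y isoy] := ex_nonisolatedT rab.
have [q [z [qD zD qz]]] : exists q z, [/\ q \notin im (a * b), z \notin im (a * b) & q != z].
  exact: ex_two_notin.
have [d0 d0P] : exists v, collapsible S (im (a * b)) v.
  by apply: ex_collapsible => //; rewrite -rankE rab.
have uniq := factorization_unique abS rab d0P _ _ _ isoy qD zD qz zD.
exact: congr_trans (uniq _ _ aU bU erefl) (congr_sym (uniq _ _ cU dU cd)).
Qed.

Lemma layerV_of_rank a : a \in S -> partial_rank a = r -> a \in V.
Proof. by move=> aS ra; rewrite inE memI aS ra leqnn !andbT; lia. Qed.

Lemma layerU a : a \in U -> [/\ a \in S, a \in I_m & r < partial_rank a].
Proof. by rewrite memU memI => /andP[/[dup] aI /andP[]]. Qed.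

(** Factor [a] as [u * f] with the image of [f] containing a point [z] that [b] sends outside the
    image of [a * b]. Then [f * b] still has rank above r and can be formed inside [U]. *)
Lemma extend_mulVU a b : a \in S -> partial_rank a = r -> b \in U -> a * b \in V ->
  extend a * F b ~~ extend (a * b).
Proof.
move=> aS ra bU abV; have [bS bI rb] := layerU bU.
have rab : #|im (a * b)| = r.
  apply/eqP; rewrite eqn_leq -{1}ra rank_mull -rankE.
  by move: abV; rewrite inE => /andP[].
have [z [s [_ bz sD]]] : exists z s, [/\ z \in setT, b z = Some s & s \notin im (a * b)].
  by apply: ex_pimage_new; rewrite pimageT rab.
have za : z \notin im a.
  by apply: contra sD => za; rewrite imM; apply/pimageP; exists z.
have [y isoy] := ex_nonisolatedT ra.
have [f [uU fU uf fD zf]] := ex_factorization aS ra isoy za za.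
set u := upd _ _ _ in uU uf.
have fbU : f * b \in U.
  have [_ fI _] := layerU fU.
  rewrite memU ideal_mul //=.
  have <- : #|s |: im (a * b)| = r.+1 by rewrite cardsU1 sD rab.
  rewrite rankE; apply/subset_leq_card/subsetP => v.
  rewrite !imM => /setU1P[->|/pimageP[x xa bx]]; apply/pimageP; first by exists z.
  by exists x => //; apply: mem_im (fD x xa).
rewrite -{1}uf; apply: congr_trans (congr_mulr _ (congr_sym (extend_mulUU uU fU _))) _;
  rewrite ?uf ?layerV_of_rank //.
rewrite -mulgA; apply: congr_trans (congr_mull _ (FM fU bU fbU)) _.
by rewrite -uf -mulgA; apply: extend_mulUU => //; rewrite mulgA uf.
Qed.

(** Factor [b] by moving a point [y] of the image of [a] that is nonisolated there. Then [a * u]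
    gains the new value [q] and stays in [U]. *)
Lemma extend_mulUV a b : a \in U -> b \in S -> partial_rank b = r -> a * b \in V ->
  F a * extend b ~~ extend (a * b).
Proof.
move=> aU bS rb abV; have [aS aI ra] := layerU aU.
have rab : #|im (a * b)| = r.
  apply/eqP; rewrite eqn_leq -{1}rb rank_mulr -rankE.
  by move: abV; rewrite inE => /andP[].
have [y ya isoy] : exists2 y, y \in im a & nonisolated b (im a) y.
  by apply: ex_nonisolated; rewrite -imM rab.
have isoyT : nonisolated b setT y.
  by case: isoy => [|[y' _ yy']]; [left|right; exists y'; rewrite ?inE].
have [q [_ [qb _ _]]] : exists q z, [/\ q \notin im b, z \notin im b & q != z].
  exact: ex_two_notin.
have [f [uU fU uf _ _]] := ex_factorization bS rb isoyT qb qb.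
set u := upd _ _ _ in uU uf.
have [_ uI _] := layerU uU.
have auU : a * u \in U.
  rewrite memU ideal_mul //=.
  have qab : q \notin im (a * b) by apply: contra qb; rewrite imM; apply/subsetP/pimage_sub.
  have <- : #|q |: im (a * b)| = r.+1 by rewrite cardsU1 qab rab.
  by rewrite rankE !imM subset_leq_card ?pimage_upd.
rewrite -{1}uf; apply: congr_trans (congr_mull _ (congr_sym (extend_mulUU uU fU _))) _;
  rewrite ?uf ?layerV_of_rank //.
rewrite mulgA; apply: congr_trans (congr_mulr _ (FM aU uU auU)) _.
by rewrite -uf mulgA; apply: extend_mulUU => //; rewrite -mulgA uf.
Qed.

Lemma extendM a b : a \in V -> b \in V -> a * b \in V ->
  extend a * extend b ~~ extend (a * b).
Proof.
move=> aV bV abV; have [aU|[aS ra]] := layerV_cases aV; have [bU|[bS rb]] := layerV_cases bV.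
- by rewrite (extendU aU) (extendU bU); apply: extend_mulUU.
- by rewrite (extendU aU); apply: extend_mulUV.
- by rewrite (extendU bU); apply: extend_mulVU.
(* With both factors of rank r, the two letters for [b] are absorbed one after the other; [a * c]
   has rank r, lying between [a] and [a * b]. *)
have [c [d [cU dU cd eb]]] := extend_factorization bS rb.
have [[cS _ _] [dS _ _]] := (layerU cU, layerU dU).
have rac : partial_rank (a * c) = r.
  apply/eqP; rewrite eqn_leq -{1}ra rank_mull /=.
  apply: leq_trans (rank_mull _ d); rewrite -mulgA cd.
  by move: abV; rewrite inE => /andP[].
have acS : a * c \in S by apply: S_mul.
have acV := layerV_of_rank acS rac.
rewrite eb mulgA; apply: congr_trans (congr_mulr _ (extend_mulVU aS ra cU acV)) _.
by rewrite -cd mulgA; apply: extend_mulVU; rewrite // -mulgA cd.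
Qed.

End Extension.

(** * Sufficiency: descending to rank epsilon *)

Lemma ex_subset_card (T : finType) (A : {set T}) k : k <= #|A| ->
  exists2 B : {set T}, B \subset A & #|B| = k.
Proof.
move=> kA; exists [set x in take k (enum A)].
  by apply/subsetP => x; rewrite inE => /mem_take; rewrite mem_enum.
rewrite cardsE (card_uniqP _) ?take_uniq ?enum_uniq // size_takel //.
by rewrite -cardE.
Qed.

Section Defining.
Variables (n : nat) (S : {set partial_map n}) (m : nat).
Hypothesis S_in : [\/ S = PT_monoid n, S = T_monoid n | S = I_monoid n].
Hypotheses (m_lt_n : m < n) (n_gt1 : 1 < n) (eps_m : epsilon S <= m).

Lemma iterated_extend (G : semigroupType) (R : G -> G -> Prop) (ev : G -> partial_map n)
    (F : partial_map n -> G) i j :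
  (forall x y, ev (x * y) = ev x * ev y) ->
  {in rank_layer S m i, forall a, ev (F a) = a} ->
  {in rank_layer S m i &, forall a b, a * b \in rank_layer S m i ->
     congruence_gen R (F a * F b) (F (a * b))} ->
  epsilon S + j <= i -> (j = 0 \/ i + n <= m + m)%N ->
  exists F' : partial_map n -> G,
  [/\ {in rank_layer S m i, F' =1 F},
      {in rank_layer S m (i - j), forall a, ev (F' a) = a} &
      {in rank_layer S m (i - j) &, forall a b, a * b \in rank_layer S m (i - j) ->
         congruence_gen R (F' a * F' b) (F' (a * b))}].
Proof.
move=> evM evF FM; elim: j => [|j IHj] ij jm; first by exists F; rewrite subn0.
have im : (i + n <= m + m)%N by case: jm.
have [|F' [F'F evF' F'M]] := IHj _ (or_intror im); first by lia.
have rE : (i - j = (i - j.+1).+1)%N by lia.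
set r := (i - j.+1)%N in rE *; rewrite rE in evF' F'M.
have FM' a b : a \in rank_layer S m r.+1 -> b \in rank_layer S m r.+1 ->
  a * b \in rank_layer S m r.+1 -> congruence_gen R (F' a * F' b) (F' (a * b)).
  by move=> *; apply: F'M.
have er : epsilon S <= r by lia.
have rn : r.+1 + n <= m + m by lia.
exists (extend S m r F'); split.
- move=> a ai; rewrite extendU ?F'F //; move: ai; rewrite !inE => /andP[-> /=].
  by apply: leq_trans; lia.
- move=> a /layerV_cases[aU|[aS ra]]; first by rewrite extendU ?evF'.
  have [b [c [bU cU <- ->]]] := extend_factorization S_in m_lt_n n_gt1 er rn F' aS ra.
  by rewrite evM !evF'.
- by move=> a b aV bV abV; apply: extendM.
Qed.

Section Words.
Variable i : nat.
Local Notation A := (layer_elt S m i).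
Local Notation word := (free_semigroup A).
Local Notation ev := (word_eval (fun a : A => sval a)).
Local Notation "u ~~ v" := (congruence_gen (@Cayley_rel n S m i) u v) (at level 70).

Lemma word_ind (P : word -> Prop) : (forall a : A, P (letter a)) ->
  (forall w a, P w -> P (w * letter a)) -> forall w, P w.
Proof.
move=> P1 PM [a s]; elim/last_ind: s => [|s b IHs]; first exact: P1.
by rewrite -cats1; apply: (PM (a, s)).
Qed.

Lemma evM (u v : word) : ev (u * v) = ev u * ev v.
Proof. exact: word_evalM. Qed.

Lemma ev_letter (a : A) : ev (letter a) = sval a.
Proof. by []. Qed.

Lemma ev_ideal (w : word) : ev w \in rank_ideal S m.
Proof.
have letterI (a : A) : sval a \in rank_ideal S m by case: a => a /= /setIdP[].
elim/word_ind: w => [a|w a IHw]; first exact: letterI.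
by rewrite evM; apply: ideal_mul => //; apply: letterI.
Qed.

Lemma congruence_ev u v : u ~~ v -> ev u = ev v.
Proof.
elim=> {u v} // [u v []|u v w _ -> _ ->|w u v _ uv|w u v _ uv] //.
- by rewrite !evM uv.
- by rewrite !evM uv.
Qed.

Lemma ex_idmap (B C : {set 'I_n}) : epsilon S <= #|C| -> C \subset B -> #|B| = m ->
  exists v, [/\ collapsible S C v, idmap B v \in S & im (idmap B v) = B].
Proof.
move=> eC CB Bm; have [v vC] := ex_collapsible n_gt1 eC.
exists v; split => //; first exact: idmap_collapsible vC.
by apply: im_idmap; case: (collapsibleW CB vC).
Qed.

Lemma defines_of_le : epsilon S <= i <= m -> (i = epsilon S \/ i + n <= m + m)%N ->
  Cayley_defines S m i.
Proof.
move=> /andP[ei im] iS.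
have [x0 _] : exists x0 : A, True.
  have [B _ Bm] : exists2 B : {set 'I_n}, B \subset [set: 'I_n] & #|B| = m.
    by apply: ex_subset_card; rewrite cardsT card_ord ltnW.
  have [|v [_ aS aB]] := @ex_idmap B B _ (subxx _) Bm; first by rewrite Bm.
  have aA : idmap B v \in rank_layer S m i by rewrite !inE aS rankE aB Bm leqnn im.
  by exists (exist _ (idmap B v) aA).
(* The letter [x0] is only a default for maps outside the layer. *)
pose F (a : partial_map n) : word := letter (insubd x0 a : A).
have evF : {in rank_layer S m i, forall a, ev (F a) = a}.
  by move=> a aA; rewrite ev_letter; apply: (insubdK x0).
have FM : {in rank_layer S m i &, forall a b, a * b \in rank_layer S m i ->
     F a * F b ~~ F (a * b)}.
  move=> a b aA bA abA; apply: congr_base; apply: Cayley_rel_intro.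
  by have := (evF _ aA, evF _ bA, evF _ abA); rewrite !ev_letter => -[[-> ->] ->].
have [||F' [F'F evF' F'M]] := @iterated_extend _ _ _ F i (i - epsilon S) evM evF FM.
- by rewrite subnKC.
- by case: iS => [->|]; [left; rewrite subnn|right].
rewrite subKn // in evF' F'M.
(* Full maps have nonempty image, so no element of the ideal has rank below epsilon. *)
have layer_eps a : a \in rank_ideal S m -> a \in rank_layer S m (epsilon S).
  move=> aI; rewrite inE aI /epsilon; case: eqP => // eS.
  have aT : a \in T_monoid n by move: aI; rewrite inE -eS => /andP[].
  pose x : 'I_n := Ordinal (ltnW n_gt1).
  case ax: (a x) (elimT (TP a) aT x) => [y|] // _.
  by rewrite rankE card_gt0; apply/set0Pn; exists y; apply: mem_im ax.
(* [F'] picks a normal form for each value, so words with equal values are congruent. *)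
have F'ev w : w ~~ F' (ev w).
  elim/word_ind: w => [a|w a IHw].
    rewrite ev_letter F'F; last by case: a.
    have -> : F (sval a) = letter a by congr letter; apply: (valKd x0).
    exact: congr_refl.
  apply: congr_trans (congr_mulr _ IHw) _.
  rewrite evM ev_letter; have -> : letter a = F' (sval a).
    by rewrite F'F; [congr letter; apply/esym/(valKd x0)|case: a].
  have aI : sval a \in rank_ideal S m := ev_ideal (letter a).
  by apply: F'M; apply: layer_eps => //; [exact: ev_ideal|apply: ideal_mul => //; apply: ev_ideal].
split=> [x|u v].
  split=> [xI|[w <-]]; last exact: ev_ideal.
  by exists (F' x); apply/evF'/layer_eps.
split=> [uv|]; last exact: congruence_ev.
by apply: congr_trans (F'ev u) _; rewrite uv; apply/congr_sym/F'ev.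
Qed.

(** * Rigidity of tight factorizations *)

Section Rigidity.
Variables al be : partial_map n.

Definition pprod (s : seq (partial_map n)) : partial_map n := foldr *%g 1 s.

(* cut c s d: s splits as s1 ++ s2 with c * pprod s1 = al and pprod s2 * d = be;
   the contexts c, d make this invariant compatible with products of words. *)
Fixpoint cut (c : partial_map n) (s : seq (partial_map n)) (d : partial_map n) :=
  ((c == al) && (pprod s * d == be)) || (if s is a :: s' then cut (c * a) s' d else false).

Lemma pprod_cat s t : pprod (s ++ t) = pprod s * pprod t.
Proof. by elim: s => [|a s IHs] /=; rewrite ?mul1g // IHs mulgA. Qed.

(** The cut at the junction is counted in both disjuncts, which is harmless for a disjunction. *)
Lemma cut_cat c s t d : cut c (s ++ t) d = cut c s (pprod t * d) || cut (c * pprod s) t d.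
Proof.
elim: s c => [|a s IHs] c /=.
  by rewrite mul1g mulg1 orbF; case: t => [|b t] /=; rewrite ?orbA orbb.
by rewrite IHs mulgA pprod_cat !mulgA orbA.
Qed.

Definition values (w : word) := [seq sval a | a <- w.1 :: w.2].

Lemma valuesM u v : values (u * v) = values u ++ values v.
Proof. by rewrite /values /= map_cat. Qed.

Lemma pprod_values w : pprod (values w) = ev w.
Proof.
elim/word_ind: w => [a|w a IHw]; first by rewrite /= mulg1.
by rewrite valuesM pprod_cat IHw evM /= mulg1.
Qed.

Hypotheses (rank_al : partial_rank al = m) (rank_be : partial_rank be = m).
Hypothesis rank_albe : partial_rank (al * be) < i.

(* Ranks being at most m, a and al have the same image, and d is injective on
   the image of b; hence a * b and al * be have the same rank. *)
Lemma no_cut_inside a b c d : a \in rank_layer S m i -> b \in rank_layer S m i ->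
  a * b \in rank_layer S m i -> c * a = al -> b * d = be -> False.
Proof.
rewrite !inE -!andbA => /and3P[_ ram _] /and3P[_ rbm _] /and3P[_ _ rab] ca bd.
have eim : im al = im a.
  apply/eqP; rewrite eqEcard -{1}ca imM pimage_sub /=.
  by rewrite -!rankE rank_al.
move: rank_albe; rewrite ltnNge => /negP[]; apply: leq_trans rab _.
have e : im (al * be) = im (a * b * d) by rewrite -bd mulgA !imM eim.
have := card_pimage_diff d (pimage_sub b (im a)).
rewrite -!imM bd -e -!rankE rank_be; lia.
Qed.

(** Quantifying over [c] and [d] carries the induction through contexts: a neighbouring word enters
    only by its value, which the congruence preserves. *)
Lemma congruence_cut u v : u ~~ v -> forall c d, cut c (values u) d = cut c (values v) d.
Proof.
elim=> {u v} //.
- move=> u v [a b e eab] c d /=; rewrite !mulg1 eab !mulgA.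
  (* The cuts before and after the relation agree on both sides; only the cut between the two
     letters could differ. *)
  suff -> : (c * sval a == al) && (sval b * d == be) = false by [].
  apply/negP => /andP[/eqP ca /eqP bd].
  by apply: (no_cut_inside (svalP a) (svalP b) _ ca bd); rewrite -eab (svalP e).
- by move=> u v w uv IH vw IH' c d; rewrite IH IH'.
- by move=> w u v uv IH c d; rewrite !valuesM !cut_cat IH !pprod_values (congruence_ev uv).
- by move=> w u v uv IH c d; rewrite !valuesM !cut_cat IH !pprod_values (congruence_ev uv).
Qed.

End Rigidity.

(** * Necessity: two incongruent factorizations of one element *)

Lemma not_defines_of_gt : epsilon S < i <= m -> m + m < i + n -> ~ Cayley_defines S m i.
Proof.
move=> /andP[ei im] ni [_ def].
have [B _ Bm] : exists2 B : {set 'I_n}, B \subset [set: 'I_n] & #|B| = m.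
  by apply: ex_subset_card; rewrite cardsT card_ord ltnW.
have [C CB Ci] : exists2 C : {set 'I_n}, C \subset B & #|C| = i.-1.
  by apply: ex_subset_card; lia.
(* The complement of [B] is large enough because m - (i - 1) <= n - m. Thus [B] and [B'] have size m
   and meet in only i - 1 points. *)
have [C' C'B C'i] : exists2 C' : {set 'I_n}, C' \subset ~: B & #|C'| = (m - i.-1)%N.
  by apply: ex_subset_card; rewrite cardsCs setCK card_ord; lia.
have C'nB x : x \in C' -> x \notin B by move=> /(subsetP C'B); rewrite inE.
pose B' := C :|: C'.
have B'm : #|B'| = m.
  rewrite cardsU (_ : C :&: C' = set0) ?cards0; first by lia.
  apply/setP => x; rewrite !inE; apply/negP => /andP[xC /C'nB/negP[]].
  exact: (subsetP CB).
have eC : epsilon S <= #|C| by lia.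
have [v [vC alS imal]] := ex_idmap eC CB Bm.
have [v' [v'C beS imbe]] := ex_idmap eC (subsetUl C C') B'm.
set al := idmap B v in alS imal; set be := idmap B' v' in beS imbe.
have rank_albe : partial_rank (al * be) < i.
  rewrite rankE imM imal; suff sub : pimage be B \subset C.
    by apply: leq_ltn_trans (subset_leq_card sub) _; rewrite Ci; lia.
  apply/subsetP => y /pimageP[x xB]; rewrite idmapE; case: ifP => [xB' [<-]|_ vy].
    by move: xB'; rewrite inE => /orP[//|/C'nB]; rewrite xB.
  by case: v'C => /(_ _ vy).
have ral : partial_rank al = m by rewrite rankE imal.
have rbe : partial_rank be = m by rewrite rankE imbe.
have [p pB] : exists p, p \in B by apply/set0Pn; rewrite -card_gt0 Bm; lia.
have [q qB] : exists q, q \notin B by apply: ex_notin; rewrite Bm.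
(* Swapping a point of the image of [al] with one outside changes [al] but cancels in the
   product. *)
pose pi : partial_map n := [ffun x => Some (tperm p q x)].
have piS : pi \in S.
  case: S_in => ->; first by rewrite inE.
    by apply/TP => x; rewrite ffunE.
  by apply/IP => x y _; rewrite !ffunE => -[/perm_inj].
have pipi : pi * pi = 1.
  by apply/ffunP => x; rewrite pmulE !ffunE /= ffunE tpermK.
have layer a : a \in S -> partial_rank a = m -> a \in rank_layer S m i.
  by move=> aS am; rewrite !inE aS am leqnn im.
have ralpi : partial_rank (al * pi) = m.
  apply/eqP; rewrite eqn_leq -{1}ral rank_mull /= -ral.
  by rewrite -[X in partial_rank X <= _](mulg1 al) -pipi mulgA rank_mull.
have rpibe : partial_rank (pi * be) = m.
  apply/eqP; rewrite eqn_leq -{1}rbe rank_mulr /= -rbe.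
  by rewrite -[X in partial_rank X <= _](mul1g be) -pipi -mulgA rank_mulr.
pose x1 : A := exist _ al (layer _ alS ral).
pose y1 : A := exist _ be (layer _ beS rbe).
pose x2 : A := exist _ (al * pi) (layer _ (S_mul S_in alS piS) ralpi).
pose y2 : A := exist _ (pi * be) (layer _ (S_mul S_in piS beS) rpibe).
have eqev : ev (letter x1 * letter y1) = ev (letter x2 * letter y2).
  by rewrite !evM !ev_letter /= mulgA -(mulgA al) pipi mulg1.
have := congruence_cut ral rbe rank_albe (proj1 (def _ _) eqev) 1 1.
have alp : al p = Some p by rewrite idmapE pB.
(* The second word has no cut at its start, middle or end, whereas the first has one in the
   middle. *)
have n1 : (1 == al) = false.
  apply: contraNF qB => /eqP al1; rewrite -imal -al1; apply/imP; exists q.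
  by rewrite ffunE.
have n2 : (al * pi == al) = false.
  apply: contraNF qB => /eqP /ffunP/(_ p).
  by rewrite pmulE alp /= ffunE tpermL => -[->].
have n3 : (al * pi * (pi * be) == al) = false.
  rewrite mulgA -(mulgA al) pipi mulg1; apply/eqP => e; move: rank_albe.
  by rewrite e ral ltnNge im.
by rewrite /= !mul1g !mulg1 n1 n2 n3 !eqxx.
Qed.

End Words.
End Defining.

(* Combining both directions and comparing with theta *)
Local Close Scope group_scope.

Theorem theorem3p3 (n : nat) (n_ge3 : 3 <= n) (S : {set partial_map n})
    (S_in : [\/ S = PT_monoid n, S = T_monoid n | S = I_monoid n])
    (m : nat) (m_bounds : epsilon S <= m < n) :
  ((m%:R <= theta S)%R ->
    forall i : nat, epsilon S <= i <= m ->
      (Cayley_defines S m i <-> i = epsilon S)) /\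
  ((theta S < m%:R)%R ->
    forall i : nat, epsilon S <= i <= m ->
      (Cayley_defines S m i <-> (i%:Z <= 2%:Z * m%:Z - n%:Z)%R)).
Proof.
have /andP[eps_m m_lt_n] := m_bounds; have n_gt1 : 1 < n := ltnW n_ge3.
have thetaE : (m%:R <= theta S)%R = (m + m <= n + epsilon S).
  by rewrite /theta Num.Theory.ler_pdivlMr // -GRing.natrM Num.Theory.ler_nat muln2 addnn.
have definesP i : epsilon S <= i <= m ->
    Cayley_defines S m i <-> (i = epsilon S \/ i + n <= m + m)%N.
  move=> /andP[ei im]; split; last by apply: defines_of_le; rewrite ?ei.
  move=> def; have [le|lt] := leqP (i + n) (m + m); [by right|left].
  apply/eqP; rewrite eqn_leq ei andbT leqNgt; apply/negP => lt_ei.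
  by apply: not_defines_of_gt def; rewrite ?lt_ei.
split=> [|]; last rewrite Order.TotalTheory.ltNge.
  rewrite thetaE => m_le i im; rewrite definesP //; split=> [|->]; last by left.
  (* Here 2m - n <= epsilon, so i <= 2m - n already forces i = epsilon. *)
  move: im => /andP[ei im] []; lia.
(* Here epsilon < 2m - n, so the alternative i = epsilon is absorbed by the inequality. *)
rewrite thetaE -ltnNge => m_gt i im; rewrite definesP //; split; lia.
Qed.
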